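(* The two-dimensional lattice, for $u_n=u_n(x,y)$, $n\in\mathbb{Z}$, $$u_{n,xy} = \alpha_n\,(u_{n,x} - u_n^2 - 1)(u_{n,y} - u_n^2 - 1) + 2 u_n\,(u_{n,x}+u_{n,y}-u_n^2 - 1),\qquad \alpha_n = \frac{1}{u_n - u_{n-1}} - \frac{1}{u_{n+1}-u_n},$$ possesses the Lax pair $$\psi_{n, x} = \frac{u_{n,x} - u_n^2-1}{u_{n+1} - u_n} (\psi_{n+1} - \psi_n) + u_n \psi_n,$$ $$\psi_{n, y} = \frac{u_{n, y} - u_n^2-1}{u_n - u_{n-1}} (\psi_n - \psi_{n-1}) + u_n \psi_n .$$
   Context: Here $u_n=u_n(x,y)$ and $\psi_n=\psi_n(x,y)$ depend on the real variables $x,y$ and on the integer $n$. Subscripts $x,y$ denote partial derivatives: $u_{n,x}=\partial u_n/\partial x$, $u_{n,xy}=\partial^2u_n/\partial x\partial y$, etc. It is assumed that $u_{n+1}\neq u_n$ for all $n$, so that all denominators are nonzero. A pair of linear equations for $\psi_n$, of the form $\psi_{n,x}=\dots$, $\psi_{n,y}=\dots$ with coefficients depending on the $u_k$ and their first derivatives, is called a Lax pair of the lattice if the lattice is its compatibility condition. That is: compute $(\psi_{n,x})_y$ and $(\psi_{n,y})_x$ by differentiating the right-hand sides and replacing each derivative $\psi_{k,x},\psi_{k,y}$ by its expression from the linear equations. The resulting relation $(\psi_{n,x})_y=(\psi_{n,y})_x$ for all $n$, regarded as an identity in the independent quantities $\psi_k$, $k\in\mathbb{Z}$, holds if and only if $\{u_n\}$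 satisfies the lattice equation for all $n$. *)

(* Defs.v *)
From Stdlib Require Import Reals ZArith.
From Coquelicot Require Import Coquelicot.
Open Scope R_scope.

Definition partial_x (f : R -> R -> R) : R -> R -> R :=
  fun x y => Derive (fun t => f t y) x.

Definition partial_y (f : R -> R -> R) : R -> R -> R :=
  fun x y => Derive (fun t => f x t) y.

(** Formal linear combinations of the independent symbols [psi_k], k in Z,
    with coefficients that are functions of (x, y). *)
Inductive psi_form : Type :=
| Psi (k : Z)
| Padd (e1 e2 : psi_form)
| Psub (e1 e2 : psi_form)
| Pscale (c : R -> R -> R) (e : psi_form).

Declare Scope psi_scope.
Delimit Scope psi_scope with psi.
Bind Scope psi_scope with psi_form.
Infix "+" := Padd : psi_scope.
Infix "-" := Psub : psi_scope.
Notation "c *: e" := (Pscale c e) (at level 40, left associativity) : psi_scope.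

Fixpoint psi_eval (psi : Z -> R) (e : psi_form) (x y : R) : R :=
  match e with
  | Psi k => psi k
  | Padd e1 e2 => psi_eval psi e1 x y + psi_eval psi e2 x y
  | Psub e1 e2 => psi_eval psi e1 x y - psi_eval psi e2 x y
  | Pscale c e => c x y * psi_eval psi e x y
  end.

(** Derivative of a form by linearity and the Leibniz rule: [d] (which is
    [partial_x] or [partial_y]) acts on the coefficients, and the derivative
    of each [psi_k] is replaced by [rhs k], its expression from the linear
    equations. *)
Fixpoint psi_deriv (d : (R -> R -> R) -> R -> R -> R) (rhs : Z -> psi_form)
    (e : psi_form) : psi_form :=
  match e with
  | Psi k => rhs k
  | Padd e1 e2 => psi_deriv d rhs e1 + psi_deriv d rhs e2
  | Psub e1 e2 => psi_deriv d rhs e1 - psi_deriv d rhs e2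
  | Pscale c e => d c *: e + c *: psi_deriv d rhs e
  end.

(** Compatibility on [D] of psi_{n,x} = F n, psi_{n,y} = G n.  The values
    [psi k] are arbitrary reals at every point: the relation is an identity in
    the psi_k, not a statement about solutions of the linear system. *)
Definition compatible (D : R * R -> Prop) (F G : Z -> psi_form) : Prop :=
  forall (n : Z) (x y : R), D (x, y) -> forall psi : Z -> R,
    psi_eval psi (psi_deriv partial_y G (F n)) x y =
    psi_eval psi (psi_deriv partial_x F (G n)) x y.

(** Fields on [D]: each [u n] is twice continuously differentiable on [D]
    ([ex_diff_n _ 2] asks for continuity of all partial derivatives of order at
    most 2), and neighbouring fields never coincide. *)
Definition admissible (D : R * R -> Prop) (u : Z -> R -> R -> R) : Prop :=
  forall (n : Z) (x y : R), D (x, y) ->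
    ex_diff_n (u n) 2 x y /\ u (n + 1)%Z x y <> u n x y.

(** [lattice u n x y] is the n-th lattice equation for [u] at (x, y);
    [F u n] and [G u n] are the right-hand sides of the equations for psi_{n,x}
    and psi_{n,y}. *)
Definition is_Lax_pair (lattice : (Z -> R -> R -> R) -> Z -> R -> R -> Prop)
    (F G : (Z -> R -> R -> R) -> Z -> psi_form) : Prop :=
  forall (D : R * R -> Prop) (u : Z -> R -> R -> R),
    open D -> admissible D u ->
    (compatible D (F u) (G u) <->
     forall (n : Z) (x y : R), D (x, y) -> lattice u n x y).

Definition alpha (u : Z -> R -> R -> R) (n : Z) (x y : R) : R :=
  1 / (u n x y - u (n - 1)%Z x y) - 1 / (u (n + 1)%Z x y - u n x y).

Definition lattice_eq (u : Z -> R -> R -> R) (n : Z) (x y : R) : Prop :=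
  partial_y (partial_x (u n)) x y =
    alpha u n x y * (partial_x (u n) x y - u n x y ^ 2 - 1)
                  * (partial_y (u n) x y - u n x y ^ 2 - 1)
    + 2 * u n x y * (partial_x (u n) x y + partial_y (u n) x y
                     - u n x y ^ 2 - 1).

Definition lax_x (u : Z -> R -> R -> R) (n : Z) : psi_form :=
  (fun x y => (partial_x (u n) x y - u n x y ^ 2 - 1)
              / (u (n + 1)%Z x y - u n x y)) *: (Psi (n + 1) - Psi n)
  + u n *: Psi n.

Definition lax_y (u : Z -> R -> R -> R) (n : Z) : psi_form :=
  (fun x y => (partial_y (u n) x y - u n x y ^ 2 - 1)
              / (u n x y - u (n - 1)%Z x y)) *: (Psi n - Psi (n - 1))
  + u n *: Psi n.

(* Main.v *)
(** Write d = u_{n+1} - u_n, e = u_n - u_{n-1}, and let L be the difference of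
    the two sides of the n-th lattice equation.  Substituting the linear
    equations into (psi_{n,x})_y - (psi_{n,y})_x, the derivatives of u_{n+1}
    and u_{n-1} and all undifferentiated terms cancel except for those in L:
    the difference is
      L * ((psi_{n+1} - psi_n) / d - (psi_n - psi_{n-1}) / e).
    Hence it vanishes when L = 0, and conversely its coefficient L / d at
    psi_{n+1} forces L = 0. *)
Require Import Defs.
From Stdlib Require Import Reals ZArith Lra Lia.
From Coquelicot Require Import Coquelicot.
Open Scope R_scope.

(** Schwarz's theorem: openness of [D] gives the first and mixed partials on a neighbourhood of the
    point, and [ex_diff_n] of order 2 gives continuity of both mixed partials at it. *)
Lemma partial_x_partial_y_comm (D : R * R -> Prop) (f : R -> R -> R) (x y : R) :
  open D -> (forall s t, D (s, t) -> ex_diff_n f 2 s t) -> D (x, y) ->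
  partial_x (partial_y f) x y = partial_y (partial_x f) x y.
Proof.
  intros HD Hf Hxy.
  destruct (Hf x y Hxy) as (_ & _ & _ & (_ & _ & _ & _ & Cyx & _)
                              & (_ & _ & _ & (Cxy & _) & _)).
  apply Schwarz; [| exact Cxy | exact Cyx].
  apply locally_2d_locally.
  apply (filter_imp D); [| exact (HD _ Hxy)].
  intros [s t] Hst.
  destruct (Hf s t Hst) as (_ & Hx & Hy & (_ & _ & Hxy' & _) & (_ & Hyx' & _)).
  now repeat split.
Qed.

(** Quotient rule for the shape shared by both Lax coefficients along a coordinate line: [p] is a
    first derivative of u_n, [f] is u_n, and [g - h] is a difference of neighbouring fields. *)
Lemma Derive_Lax_coefficient (p f g h : R -> R) (s : R) :
  ex_derive p s -> ex_derive f s -> ex_derive g s -> ex_derive h s ->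
  g s - h s <> 0 ->
  Derive (fun t => (p t - f t ^ 2 - 1) / (g t - h t)) s =
  (Derive p s - 2 * f s * Derive f s) / (g s - h s)
  - (p s - f s ^ 2 - 1) * (Derive g s - Derive h s) / (g s - h s) ^ 2.
Proof.
  intros Hp Hf Hg Hh Hgh.
  apply is_derive_unique.
  auto_derive; [now repeat split|].
  change (fun x : R => p x) with p; change (fun x : R => f x) with f.
  change (fun x : R => g x) with g; change (fun x : R => h x) with h.
  now field.
Qed.

Lemma Lax_compatibility_defect (D : R * R -> Prop) (u : Z -> R -> R -> R)
    (n : Z) (x y : R) (psi : Z -> R) :
  open D -> admissible D u -> D (x, y) ->
  psi_eval psi (psi_deriv partial_y (lax_y u) (lax_x u n)) x y
  - psi_eval psi (psi_deriv partial_x (lax_x u) (lax_y u n)) x y =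
  (partial_y (partial_x (u n)) x y -
   (alpha u n x y * (partial_x (u n) x y - u n x y ^ 2 - 1)
                  * (partial_y (u n) x y - u n x y ^ 2 - 1)
    + 2 * u n x y * (partial_x (u n) x y + partial_y (u n) x y
                     - u n x y ^ 2 - 1)))
  * ((psi (n + 1)%Z - psi n) / (u (n + 1)%Z x y - u n x y)
     - (psi n - psi (n - 1)%Z) / (u n x y - u (n - 1)%Z x y)).
Proof.
  intros HD Hu Hxy.
  (* The coefficients of [lax_x] and [lax_y] contribute the mixed derivative in opposite orders;
     these must agree for a single factor L to come out. *)
  assert (Hcomm : partial_x (partial_y (u n)) x y
                  = partial_y (partial_x (u n)) x y).
  { apply (partial_x_partial_y_comm D); auto.
    intros s t Hst; apply (Hu n s t Hst). }
  destruct (Hu n x y Hxy)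
    as ((_ & Hx & Hy & (_ & _ & Hxy' & _) & (_ & Hyx' & _)) & Hd).
  destruct (Hu (n + 1)%Z x y Hxy) as ((_ & _ & Hy1 & _) & _).
  destruct (Hu (n - 1)%Z x y Hxy) as ((_ & Hx1 & _) & He).
  rewrite Z.sub_add in He.
  assert (Hd0 : u (n + 1)%Z x y - u n x y <> 0) by lra.
  assert (He0 : u n x y - u (n - 1)%Z x y <> 0) by lra.
  cbn [lax_x lax_y psi_deriv psi_eval].
  (* Replacing psi_{n+1,y} and psi_{n-1,x} brings in the indices n+1-1 and n-1+1; reducing both to n
     makes their denominators the same d and e. *)
  rewrite Z.sub_add, Z.add_simpl_r.
  set (A' := partial_y (fun x0 y0 => _ / _) x y).
  set (B' := partial_x (fun x0 y0 => _ / _) x y).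
  assert (HA : A' = (partial_y (partial_x (u n)) x y
                     - 2 * u n x y * partial_y (u n) x y)
                    / (u (n + 1)%Z x y - u n x y)
                    - (partial_x (u n) x y - u n x y ^ 2 - 1)
                      * (partial_y (u (n + 1)%Z) x y - partial_y (u n) x y)
                      / (u (n + 1)%Z x y - u n x y) ^ 2)
    by now apply (Derive_Lax_coefficient (fun t => partial_x (u n) x t)
                    (fun t => u n x t) (fun t => u (n + 1)%Z x t)
                    (fun t => u n x t)).
  assert (HB : B' = (partial_x (partial_y (u n)) x y
                     - 2 * u n x y * partial_x (u n) x y)
                    / (u n x y - u (n - 1)%Z x y)
                    - (partial_y (u n) x y - u n x y ^ 2 - 1)
                      * (partial_x (u n) x y - partial_x (u (n - 1)%Z) x y)
                      / (u n x y - u (n - 1)%Z x y) ^ 2)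
    by now apply (Derive_Lax_coefficient (fun t => partial_y (u n) t y)
                    (fun t => u n t y) (fun t => u n t y)
                    (fun t => u (n - 1)%Z t y)).
  rewrite HA, HB, Hcomm.
  unfold alpha.
  now field.
Qed.

Theorem theorem2p1 : is_Lax_pair lattice_eq lax_x lax_y.
Proof.
  intros D u HD Hu; split.
  - intros Hc n x y Hxy.
    (* The indicator of n+1 kills psi_n and psi_{n-1}, so the factor multiplying L becomes 1/d,
       which is nonzero. *)
    set (psi := fun k : Z => if Z.eq_dec k (n + 1) then 1 else 0).
    assert (Hdef := Lax_compatibility_defect D u n x y psi HD Hu Hxy).
    rewrite (Hc n x y Hxy psi), Rminus_diag in Hdef.
    unfold psi in Hdef.
    destruct (Z.eq_dec (n + 1) (n + 1)) as [_ |]; [| lia].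
    destruct (Z.eq_dec n (n + 1)); [lia |].
    destruct (Z.eq_dec (n - 1) (n + 1)); [lia |].
    destruct (Hu n x y Hxy) as [_ Hd].
    apply eq_sym, Rmult_integral in Hdef as [HL | Hcoef].
    + now apply Rminus_diag_uniq.
    + exfalso.
      apply (Rinv_neq_0_compat (u (n + 1)%Z x y - u n x y)); [lra |].
      unfold Rdiv in Hcoef; lra.
  - intros Hlat n x y Hxy psi.
    apply Rminus_diag_uniq.
    rewrite (Lax_compatibility_defect D u n x y psi HD Hu Hxy).
    rewrite (Hlat n x y Hxy).
    ring.
Qed.
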